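(* The two lower bounds $\mathrm{def}(G)$ and $$\mathrm{spec}(G):=\frac{\sum_{v\in V(G)}d(v)^2-|E(G)|\,\lambda_n}{4}$$ for $\ell(\mathcal A(G))$, $G$ a finite simple graph, are incomparable (neither is at most the other for all $G$). More precisely: (i) on odd cycles $C_{2k+1}$ the defect bound is exact, i.e. $\mathrm{def}(C_{2k+1})=\ell(\mathcal A(C_{2k+1}))$, while $\mathrm{spec}(C_{2k+1})\to0$ as $k\to\infty$; (ii) on complete multipartite graphs $G$, the spectral lower bound captures exactly $3/4$ of the true value, i.e. $\mathrm{spec}(G)=\frac34\,\ell(\mathcal A(G))$.
   Context: Here $d(v)$ is the degree of $v$, $n=|V(G)|$, and $\lambda_n$ is the largest eigenvalue of the Laplacian (degree matrix minus adjacency matrix). The Max-Cut defect $\mathrm{def}(G)=|E(G)|-\mathrm{MaxCut}(G)$ is the minimum number of edges whose removal makes $G$ bipartite. Fix an orientation of the edges of $G=(V,E)$; the oriented incidence matrix $D$ is the $|V|\times|E|$ matrix with $D_{ve}=+1$ if $v$ is the head of $e$, $-1$ if $v$ is the tail of $e$, and $0$ otherwise. The antisymmetric line graph $\mathcal A(G)$ is the signed graph with vertex set $E(G)$ and signed adjacency matrix $D^{\mathsf T}D-2I$ (nonzero entries are edges, with the entry $\pm1$ as sign). Switching a signed graph at a vertex reverses the signs of all edges incident to it; changing the orientation changes $\mathcal A(G)$ only by switching. The sign of a cycle is the product of its edge signs, and a signed graph is balanced if all its cycles are positive. The frustration index $\ell(\Sigma)$ of a signed graph $\Sigma$ is the minimum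 number of edges whose deletion makes $\Sigma$ balanced (equivalently, the minimum number of negative edges among all switchings of $\Sigma$); it is switching invariant. *)

(* Defs.v *)
From HB Require Import structures.
From mathcomp Require Import all_boot all_order all_algebra.
From mathcomp Require Import all_classical all_reals all_analysis.

Set Implicit Arguments.
Unset Strict Implicit.
Unset Printing Implicit Defensive.

Import Order.TTheory GRing.Theory Num.Theory.
Import numFieldNormedType.Exports.

Local Open Scope ring_scope.

Record sgraph := SGraph {
  vertex :> finType;
  adj : rel vertex;
  adj_sym : symmetric adj;
  adj_irrefl : irreflexive adj
}.

Definition edges (G : sgraph) : {set {set G}} :=
  [set [set p.1; p.2] | p in [pred p : G * G | adj p.1 p.2]].

Definition edge (G : sgraph) := {e : {set G} | e \in edges G}.

Definition degree (G : sgraph) (v : G) : nat := #|[set w | adj v w]|.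

Definition cut_edges (G : sgraph) (S : {set G}) : {set {set G}} :=
  [set e in edges G | #|e :&: S| == 1%N].

Definition maxcut (G : sgraph) : nat := \max_(S : {set G}) #|cut_edges S|.

Definition maxcut_defect (G : sgraph) : nat := (#|edges G| - maxcut G)%N.

Definition degree_mx (R : realType) (G : sgraph) : 'M[R]_#|G| :=
  diag_mx (\row_i (degree (enum_val i))%:R).

Definition adjacency_mx (R : realType) (G : sgraph) : 'M[R]_#|G| :=
  \matrix_(i, j) (adj (enum_val i) (enum_val j))%:R.

Definition laplacian (R : realType) (G : sgraph) : 'M[R]_#|G| :=
  degree_mx R G - adjacency_mx R G.

(* The set of eigenvalues is finite, and contains 0 as soon as G has a vertex, *)
(* so that the supremum is a maximum; sup set0 = 0 for the graph with no      *)
(* vertices.                                                                  *)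
Definition lambda_max (R : realType) (G : sgraph) : R :=
  sup [set a | eigenvalue (laplacian R G) a]%classic.

Definition spec (R : realType) (G : sgraph) : R :=
  ((\sum_(v : G) degree v ^ 2)%N%:R - #|edges G|%:R * lambda_max R G) / 4.

Record signed_graph := SignedGraph {
  svertex :> finType;
  sadj : svertex -> svertex -> int;
  sadj_sym : forall x y, sadj x y = sadj y x;
  sadj_irrefl : forall x, sadj x x = 0;
  sadj_val : forall x y, sadj x y \in [:: -1; 0; 1]
}.

Definition sedges (S : signed_graph) : {set {set S}} :=
  [set [set p.1; p.2] | p in [pred p : S * S | sadj p.1 p.2 != 0]].

Section Deletion.
Variables (S : signed_graph) (F : {set {set S}}).

Definition del_sadj (x y : S) : int :=
  if [set x; y] \in F then 0 else sadj x y.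

Lemma del_sadj_sym x y : del_sadj x y = del_sadj y x.
Proof. by rewrite /del_sadj finset.setUC sadj_sym. Qed.

Lemma del_sadj_irrefl x : del_sadj x x = 0.
Proof. by rewrite /del_sadj sadj_irrefl if_same. Qed.

Lemma del_sadj_val x y : del_sadj x y \in [:: -1; 0; 1].
Proof. by rewrite /del_sadj; case: ifP => // _; exact: sadj_val. Qed.

Definition del_edges : signed_graph :=
  SignedGraph del_sadj_sym del_sadj_irrefl del_sadj_val.

End Deletion.

Definition is_cycle (S : signed_graph) (c : seq S) : bool :=
  [&& (2 < size c)%N, uniq c & cycle (fun x y => sadj x y != 0) c].

Definition cycle_sign (S : signed_graph) (c : seq S) : int :=
  \prod_(x <- c) sadj x (next c x).

Definition balanced (S : signed_graph) : Prop :=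
  forall c : seq S, is_cycle c -> cycle_sign c = 1.

(* Deleting all the edges leaves a balanced graph, so the minimum is taken   *)
(* over a nonempty family.                                                   *)
Definition frustration (S : signed_graph) : nat :=
  #|[arg min_(F < sedges S |
        (F \subset sedges S) && `[< balanced (del_edges F) >]) #|F| ]%N|.

Record orientation (G : sgraph) := Orientation {
  tail : edge G -> G;
  head : edge G -> G;
  tail_head : forall e, val e = [set tail e; head e]
}.

Lemma orientation_exists (G : sgraph) : inhabited (orientation G).
Proof.
have ends (e : edge G) : exists p : G * G, val e == [set p.1; p.2].
  by have /imsetP[p _ eE] := valP e; exists p; apply/eqP.
constructor; exact: (@Orientation G (fun e => (xchoose (ends e)).1)
  (fun e => (xchoose (ends e)).2) (fun e => eqP (xchooseP (ends e)))).
Qed.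

Definition incidence_mx (G : sgraph) (o : orientation G) :
    'M[int]_(#|G|, #|{: edge G}|) :=
  \matrix_(i, j)
    let v := enum_val i in let e := enum_val j in
    if v == head o e then 1 else if v == tail o e then -1 else 0.

Section AntisymmetricLineGraph.
Variables (G : sgraph) (o : orientation G).

Definition antisym_line_sadj (e f : edge G) : int :=
  ((incidence_mx o)^T *m incidence_mx o - 2%:M) (enum_rank e) (enum_rank f).

Let inc (v : G) (e : edge G) : int :=
  if v == head o e then 1 else if v == tail o e then -1 else 0.

Let antisym_line_sadjE e f :
  antisym_line_sadj e f = \sum_v inc v e * inc v f - (e == f)%:R *+ 2.
Proof.
rewrite /antisym_line_sadj !mxE (inj_eq enum_rank_inj) -mulrnA mulnC mulrnA.
congr (_ - _).
rewrite (reindex (@enum_val G G)) /=; last first.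
  by exists enum_rank => x _; rewrite ?enum_valK ?enum_rankK.
by apply: eq_bigr => i _; rewrite !mxE /inc !enum_rankK.
Qed.

Let tail_neq_head (e : edge G) : tail o e != head o e.
Proof.
have /imsetP[[x y]] := valP e; rewrite inE /= => xy eE.
apply/eqP => th; have := tail_head o e; rewrite th [val e]eE finset.setUid => /setP E.
have := E x; have := E y; rewrite !inE !eqxx orbT /= => /esym/eqP Ey.
by move=> /esym/eqP Ex; rewrite Ex Ey adj_irrefl in xy.
Qed.

Let inc_neq0 v e : (inc v e != 0) = (v \in val e).
Proof.
rewrite (tail_head o) !inE /inc orbC.
by case: (v == head o e) => //=; case: (v == tail o e).
Qed.

Let inc_val v e : inc v e \in [:: -1; 0; 1].
Proof. by rewrite /inc; case: ifP => // _; case: ifP. Qed.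

Lemma antisym_line_sadj_sym e f : antisym_line_sadj e f = antisym_line_sadj f e.
Proof.
rewrite !antisym_line_sadjE eq_sym; congr (_ - _).
by apply: eq_bigr => v _; rewrite mulrC.
Qed.

Lemma antisym_line_sadj_irrefl e : antisym_line_sadj e e = 0.
Proof.
rewrite antisym_line_sadjE eqxx (bigD1 (head o e)) //= (bigD1 (tail o e)) /=;
  last exact: tail_neq_head.
rewrite big1 => [|v /andP[vh vt]]; last first.
  by rewrite /inc (negPf vh) (negPf vt) mulr0.
by rewrite /inc !eqxx (negPf (tail_neq_head e)).
Qed.

Lemma antisym_line_sadj_val e f : antisym_line_sadj e f \in [:: -1; 0; 1].
Proof.
have [->|ef] := eqVneq e f; first by rewrite antisym_line_sadj_irrefl.
rewrite antisym_line_sadjE (negPf ef) mul0rn subr0.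
have card2 (g : edge G) : #|val g| = 2%N by rewrite (tail_head o) cards2 tail_neq_head.
have zero v : v \notin val e :&: val f -> inc v e * inc v f = 0.
  rewrite inE -!inc_neq0 negb_and !negbK => /orP[]/eqP ->.
    by rewrite mul0r.
  by rewrite mulr0.
have : (#|val e :&: val f| < 2)%N.
  rewrite ltn_neqAle -{2}(card2 e) subset_leq_card ?finset.subsetIl // andbT.
  apply: contra ef => /eqP c2; apply/eqP/val_inj.
  have /eqP <- : val e :&: val f == val e.
    by rewrite eqEcard finset.subsetIl card2 c2.
  by apply/eqP; rewrite eqEcard finset.subsetIr card2 c2.
case: (set_0Vmem (val e :&: val f)) => [E0 _|[v vE] c1].
  by rewrite big1 // => v _; rewrite zero // E0 inE.
have cE : #|val e :&: val f| = 1%N.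
  by apply/eqP; rewrite eqn_leq -ltnS c1 card_gt0; apply/set0Pn; exists v.
have /cards1P[w wE] : #|val e :&: val f| == 1%N by rewrite cE.
rewrite (bigD1 w) //= big1 ?addr0 => [|u uw]; last by rewrite zero // wE inE.
by move: (inc_val w e) (inc_val w f); rewrite !inE =>
  /or3P[]/eqP -> /or3P[]/eqP ->.
Qed.

Definition antisym_line : signed_graph :=
  SignedGraph antisym_line_sadj_sym antisym_line_sadj_irrefl
              antisym_line_sadj_val.

End AntisymmetricLineGraph.

Section CycleGraph.
Variable n : nat.

(* The guard i != j only matters for n = 1, where ordS i = i. *)
Definition cycle_adj (i j : 'I_n) : bool :=
  (i != j) && ((ordS i == j) || (ordS j == i)).

Lemma cycle_adj_sym : symmetric cycle_adj.
Proof. by move=> i j; rewrite /cycle_adj eq_sym orbC. Qed.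

Lemma cycle_adj_irrefl : irreflexive cycle_adj.
Proof. by move=> i; rewrite /cycle_adj eqxx. Qed.

Definition cycle_graph : sgraph := SGraph cycle_adj_sym cycle_adj_irrefl.

End CycleGraph.

Definition complete_multipartite (G : sgraph) : Prop :=
  exists (I : finType) (part : G -> I),
    forall x y : G, adj x y = (part x != part y).

(* Main.v *)
(* Reversing edges and switching correspond, so a switching of the            *)
(* antisymmetric line graph is an orientation of G, and its negative edges    *)
(* are the pairs of edges meeting at a vertex v with one entering and one     *)
(* leaving. There are in(v) out(v) = (d(v)^2 - y(v)^2) / 4 of them at v, with  *)
(* y(v) = in(v) - out(v). By Harary's theorem the frustration index l is the  *)
(* minimum over orientations of their total number, i.e.                      *)
(*    4 l = sum_v d(v)^2 - max sum_v y(v)^2.                                  *)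
(* Since y = D x with x a vector of signs, sum_v y(v)^2 <= |E| lambda_n, which *)
(* is the spectral bound. For the defect, cut along the sign of y: each uncut *)
(* edge is paid for by min (in(v), out(v)) <= in(v) out(v). When all degrees  *)
(* are at most 2, as in cycles, these two are equal and the bound is exact.   *)
(* Each triangle contains at least one in-out path, and exactly one if it is  *)
(* transitive; so l is at least the number T of triangles, and orienting a    *)
(* complete multipartite graph along an order of its parts gives l = T, while *)
(* lambda_n = n yields sum_v d(v)^2 - |E| n = 3 T. The graphs K_3 and K_7      *)
(* witness the incomparability.                                               *)

Require Import Defs.
From HB Require Import structures.
From mathcomp Require Import all_boot all_order all_algebra.
From mathcomp Require Import all_classical all_reals all_analysis.
From mathcomp Require Import complex spectral zify ring lra.

Import Defs.
Import Order.TTheory GRing.Theory Num.Theory.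
Import numFieldNormedType.Exports.

Set Implicit Arguments.
Unset Strict Implicit.
Unset Printing Implicit Defensive.

Local Open Scope ring_scope.

(** All claims follow from one identity, [four_card_negative_edges]: for a choice [x] of signs on
    the edges of G, four times the number of negative edges of the switched line graph is the sum
    over v of d(v)^2 - y(v)^2, with y = D x. Harary's theorem ([balanced_switch], [switch_balanced])
    makes the frustration index a minimum over such [x]. Since [x] amounts to an orientation of G
    with imbalance y, this gives [frustration_le_orientation] and [frustration_orientation], and the
    rest is estimates on imbalances.

    For the defect, the sum of |y(v)| is at most twice a maximum cut, with equality available when
    cut edges are oriented across a maximum cut ([maxcut_defect_le], [maxcut_defect_degree2]). For
    the spectrum, y is the divergence of a vector of signs, so its squared norm is at most |E| times
    the largest Laplacian eigenvalue ([sum_imbalance_sqr_le]).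

    On a complete multipartite graph both the frustration index and the spectral bound are multiples
    of the number of triangles ([frustration_multipartite], [sum_degree_multipartite]). On an odd
    cycle with n vertices the eigenvalue 2 + 2 cos(pi/n) is within O(1/n^2) of 4, while spec is n (4
    - [lambda_max]) / 4, hence O(1/n). *)

Section SymmetricMatrix.
Local Open Scope sesquilinear_scope.

(** Over the complex closure of R the matrix is Hermitian, so it is unitarily diagonalizable with
    real spectrum. A real root of the characteristic polynomial is already an eigenvalue over R,
    hence at most [m], and the inequality holds term by term in the diagonalizing coordinates. *)
Lemma rayleigh_le (R : rcfType) n (A : 'M[R]_n) (m : R) : A^T = A ->
  (forall a, eigenvalue A a -> a <= m) ->
  forall y : 'rV_n, (y *m A *m y^T) 0 0 <= m * (y *m y^T) 0 0.
Proof.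
move=> symA Am y.
pose C : numClosedFieldType := complex R.
pose toC : {rmorphism R -> C} := real_complex R.
pose B := map_mx toC A.
have realC (x : R) : toC x \is Num.real by apply/complex_realP; exists x.
have hB : B \is hermsymmx.
  apply: realsym_hermsym.
    by apply/is_hermitianmxP; rewrite expr0 scale1r map_mx_id //;
      rewrite /B -[LHS]/(map_mx toC A) -{1}symA map_trmx.
  by apply/mxOverP => i j; rewrite mxE.
have /orthomx_spectralP BE := hermitian_normalmx hB.
have /mxOverP dreal := hermitian_spectral_diag_real hB.
have uP := spectral_unitarymx B.
have uU := unitarymx_unit uP.
set P := spectralmx B in BE uP uU; set d := spectral_diag B in BE dreal.
have dm i : d 0 i <= toC m.
  have /complex_realP[k dk] := dreal 0 i.
  rewrite dk lecR; apply: Am; rewrite eigenvalue_root_char.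
  rewrite -(fmorph_root toC) map_char_poly -/B -eigenvalue_root_char.
  apply/eigenvalueP; exists (row i P).
    rewrite -row_mul BE !mulmxA mulmxV // mul1mx row_mul row_diag_mx.
    by rewrite -scalemxAl -rowE dk.
  (* A row of the invertible [P] cannot vanish. *)
  apply/eqP => r0.
  have /matrixP/(_ i i) := mulmxV uU.
  have : row i (P *m invmx P) = 0 by rewrite row_mul r0 mul0mx.
  by move/rowP/(_ i); rewrite !mxE => -> /esym/eqP; rewrite eqxx oner_eq0.
pose z := map_mx toC y *m P^t*.
have map_mul (p q r : nat) (U : 'M[R]_(p, q)) (V : 'M[R]_(q, r)) :
  map_mx toC (U *m V) = map_mx toC U *m map_mx toC V by exact: map_mxM.
have toCy : (map_mx toC y)^T = (map_mx toC y)^t*.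
  apply/matrixP => i j; rewrite !mxE; apply/esym/CrealP; exact: realC.
have mapT : (map_mx toC y)^T = map_mx toC y^T by apply/matrixP => i j; rewrite !mxE.
have zT : P *m (map_mx toC y)^T = z^t*.
  by rewrite /z trmx_mul map_mxM trmxCK {1}toCy.
rewrite -lecR -[X in X <= _]/(toC _) -[X in _ <= X]/(toC _) rmorphM.
have -> : toC ((y *m y^T) 0 0) = (z *m z^t*) 0 0.
  rewrite -zT /z mulmxA -(mulmxA _ _ P) -(invmx_unitary uP) mulVmx // mulmx1.
  by rewrite mapT -map_mul [RHS]mxE.
have -> : toC ((y *m A *m y^T) 0 0) = (z *m diag_mx d *m z^t*) 0 0.
  rewrite -zT /z -(invmx_unitary uP) -!mulmxA (mulmxA (diag_mx d)).
  rewrite (mulmxA (invmx P)) (mulmxA (invmx P)) -BE.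
  by rewrite mapT -!map_mul mulmxA [RHS]mxE.
rewrite [X in X <= _]mxE [X in _ <= _ * X]mxE mulr_sumr ler_sum // => i _.
rewrite mul_mx_diag [in X in X <= _]mxE [(z^t*) i 0]mxE [z^T i 0]mxE.
rewrite mulrAC (mulrC _ (d 0 i)).
by rewrite ler_wpM2r // mul_conjC_ge0.
Qed.

End SymmetricMatrix.

(** The map sending an ordered pair to its underlying set has fibres of size exactly two on [r]. *)
Lemma card_unordered_pairs (T : finType) (r : rel T) :
  symmetric r -> irreflexive r ->
  (#|[set [set p.1; p.2] | p in [pred p : T * T | r p.1 p.2]]| * 2 =
   \sum_u \sum_v r u v)%N.
Proof.
move=> rS rI; rewrite pair_bigA /=.
transitivity (\sum_(p : T * T | r p.1 p.2) 1)%N; last first.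
  by rewrite big_mkcond; apply: eq_bigr => p _; case: (r _ _).
rewrite (partition_big_imset (fun p : T * T => [set p.1; p.2]%SET)) /=.
rewrite -sum_nat_const; apply: eq_bigr => A /imsetP[[x y]].
rewrite inE /= => rxy ->; rewrite sum1dep_card.
have xy : x != y by apply: contraTneq rxy => ->; rewrite rI.
transitivity #|[set (x, y); (y, x)]%SET|.
  by rewrite cards2 xpair_eqE negb_and xy.
apply: eq_card => -[u v]; rewrite !inE /= -[(u, v) \in _]/(r u v).
apply/idP/idP.
  by move=> /orP[]/eqP[-> ->]; rewrite ?rxy ?eqxx // rS rxy finset.setUC eqxx.
move=> /andP[ruv /eqP E].
have uv : u != v by apply: contraTneq ruv => ->; rewrite rI.
have := in_set2 u x y; rewrite -E !inE eqxx => /esym /orP[]/eqP uE.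
  have := in_set2 v x y; rewrite -E !inE eqxx orbT => /esym /orP[]/eqP vE.
    by rewrite uE vE eqxx in uv.
  by rewrite uE vE eqxx.
have := in_set2 v x y; rewrite -E !inE eqxx orbT => /esym /orP[]/eqP vE.
  by rewrite uE vE eqxx orbT.
by rewrite uE vE eqxx in uv.
Qed.

Lemma not_uniq_split (T : eqType) (s : seq T) : ~~ uniq s ->
  exists y p1 p2 p3, s = p1 ++ y :: p2 ++ y :: p3.
Proof.
elim: s => //= a s IHs; rewrite negb_and negbK => /orP[/splitPr[p q]|/IHs].
  by exists a, [::], p, q.
by move=> [y [p1 [p2 [p3 ->]]]]; exists y, (a :: p1), p2, p3.
Qed.

(** * Harary's theorem: balance is equivalent to being switchable to all-positive *)

Section Balance.
Variable S : signed_graph.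
Implicit Types (x y u v : S) (p : seq S).

Let sedge u v := sadj u v != 0.

Lemma sadj_sqr u v : sedge u v -> sadj u v ^+ 2 = 1.
Proof. by rewrite /sedge; have := sadj_val u v; rewrite !inE => /or3P[]/eqP ->. Qed.

Let sedge_sym : symmetric sedge.
Proof. by move=> u v; rewrite /sedge sadj_sym. Qed.

Fixpoint walk_sign x p : int :=
  if p is y :: p' then sadj x y * walk_sign y p' else 1.

Lemma walk_sign_cat x p q :
  walk_sign x (p ++ q) = walk_sign x p * walk_sign (last x p) q.
Proof. by elim: p x => [|y p IHp] x /=; rewrite ?mul1r // IHp mulrA. Qed.

Lemma walk_sign_rev x p : walk_sign (last x p) (rev (belast x p)) = walk_sign x p.
Proof.
elim: p x => //= y p IHp x; rewrite rev_cons -cats1 walk_sign_cat IHp /= mulr1.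
suff -> : last (last y p) (rev (belast y p)) = y by rewrite mulrC sadj_sym.
by case: p {IHp} => //= w p; rewrite rev_cons last_rcons.
Qed.

Lemma walk_sign_sqr x p : path sedge x p -> walk_sign x p ^+ 2 = 1.
Proof.
elim: p x => [|y p IHp] x /=; first by rewrite expr1n.
by case/andP=> xy /IHp; rewrite exprMn sadj_sqr // mul1r.
Qed.

Lemma walk_signE z x p :
  walk_sign x p = \prod_(i < size p) sadj (nth z (x :: p) i) (nth z p i).
Proof.
elim: p x => [|y p IHp] x /=; first by rewrite big_ord0.
by rewrite big_ord_recl IHp.
Qed.

Lemma cycle_signE x (c : seq S) : uniq c -> cycle_sign c = walk_sign (last x c) c.
Proof.
case: c => [|y p] u; first by rewrite /cycle_sign big_nil.
transitivity (walk_sign y (rcons p y)); last first.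
  by rewrite -cats1 walk_sign_cat /= mulr1 mulrC.
rewrite (walk_signE y) size_rcons /cycle_sign (big_nth y) big_mkord.
apply: eq_bigr => i _; congr (sadj _ _).
  by rewrite -rcons_cons nth_rcons ltn_ord.
rewrite next_nth mem_nth // index_uniq //.
have := ltn_ord i; rewrite ltnS leq_eqVlt nth_rcons => /orP[/eqP ->|->] //.
by rewrite ltnn eqxx nth_default.
Qed.

(** Strong induction on length: at a repeated vertex the closed walk splits into two shorter closed
    walks whose signs multiply. Without repetition it is empty, an edge traversed back and forth, or
    a genuine cycle. *)
Lemma balanced_closed_walk x p : balanced S ->
  path sedge x p -> last x p = x -> walk_sign x p = 1.
Proof.
move=> bal; have [n] := ubnP (size p); elim: n p x => // n IHn p x pn xp lx.
have [u|/not_uniq_split[y [p1 [p2 [p3 pE]]]]] := boolP (uniq p); last first.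
  move: xp lx pn; rewrite pE last_cat /= last_cat /= cat_path /= cat_path /=.
  rewrite !size_cat /= size_cat /=.
  move=> /and3P[xp1 p1y /and3P[yp2 p2y yp3]] lx pn.
  have c2 : walk_sign y (rcons p2 y) = 1.
    apply: IHn; first by rewrite size_rcons; lia.
      by rewrite rcons_path yp2.
    by rewrite last_rcons.
  have c1 : walk_sign x (p1 ++ y :: p3) = 1.
    apply: IHn; first by rewrite size_cat /=; lia.
      by rewrite cat_path /= xp1 p1y.
    by rewrite last_cat.
  move: c1 c2; rewrite -cats1 !walk_sign_cat /= walk_sign_cat /= mulr1 => c1 c2.
  by rewrite [walk_sign y p2 * _]mulrA c2 mul1r.
case: p pn xp lx u => [|a [|b [|c p]]] //= pn.
- by move=> /andP[xa _] ax; rewrite /sedge ax sadj_irrefl eqxx in xa.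
- by move=> /and3P[xa _ _] -> _; rewrite mulr1 (sadj_sym a x) -expr2 sadj_sqr.
move=> xp lx u; rewrite -[RHS](bal [:: a, b, c & p]); last first.
  by apply/and3P; split=> //; rewrite (cycle_path x) /= lx.
by rewrite (cycle_signE x) //= lx.
Qed.

(** The sign of a chosen walk from the root of the component serves as a potential. Going from the
    root to u, along uv, and back to the root is a closed walk, hence positive. *)
Lemma balanced_switch : balanced S -> exists x : S -> int,
  (forall u, x u ^+ 2 = 1) /\ forall u v, sadj u v != 0 -> sadj u v = x u * x v.
Proof.
move=> bal; pose r := fingraph.root sedge.
have csym : connect_sym sedge := sym_connect_sym sedge_sym.
have pathr v : exists p, path sedge (r v) p /\ v = last (r v) p.
  have : connect sedge (r v) v by rewrite csym connect_root.
  by case/connectP=> p ? ?; exists p.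
have [f fP] := boolp.choice pathr.
exists (fun v => walk_sign (r v) (f v)); split=> [u|u v uv].
  by rewrite walk_sign_sqr //; case: (fP u).
have ruv : r v = r u by apply/esym/eqP; rewrite root_connect // connect1.
have [pu lu] := fP u; have [pv lv] := fP v; rewrite ruv in pv lv *.
have rv : path sedge v (rev (belast (r u) (f v))).
  have := rev_path sedge (r u) (f v); rewrite -lv => ->.
  by rewrite (eq_path (e' := sedge)) // => a b; exact: sedge_sym.
have : walk_sign (r u) (f u ++ v :: rev (belast (r u) (f v))) = 1.
  apply: balanced_closed_walk => //; first by rewrite cat_path pu -lu /= rv andbT.
  rewrite last_cat /=; case: (f v) lv => //= a q _.
  by rewrite rev_cons last_rcons.
rewrite walk_sign_cat /= -lu {2}lv walk_sign_rev.
set a := walk_sign _ _; set b := walk_sign _ _ => E.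
have a2 : a ^+ 2 = 1 by rewrite walk_sign_sqr.
have b2 : b ^+ 2 = 1 by rewrite walk_sign_sqr.
have -> : sadj u v = a ^+ 2 * b ^+ 2 * sadj u v by rewrite a2 b2 !mul1r.
by rewrite -[RHS]mulr1 -E; ring.
Qed.

(** The sign of a walk telescopes to the product of [x] at its two ends. *)
Lemma switch_balanced (x : S -> int) : (forall u, x u ^+ 2 = 1) ->
  (forall u v, sadj u v != 0 -> sadj u v = x u * x v) -> balanced S.
Proof.
move=> x2 xs c /and3P[_ u c_path]; case: c u c_path => [|a c] u cc.
  by rewrite /cycle_sign big_nil.
rewrite (cycle_signE a) //=; rewrite (cycle_path a) /= in cc.
have ws y p : path sedge y p -> walk_sign y p = x y * x (last y p).
  elim: p y => [|z p IHp] y /=; first by rewrite -expr2 x2.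
  case/andP=> yz /IHp ->; rewrite xs // -[RHS]mul1r -(x2 z); ring.
by rewrite -[LHS]/(walk_sign (last a c) (a :: c)) ws //= -expr2 x2.
Qed.

End Balance.

(** * Frustration index as a minimum over switchings *)

Section Frustration.
Variable S : signed_graph.

Definition negative_edges (x : S -> int) : {set {set S}} :=
  [set [set p.1; p.2] |
    p in [pred p : S * S | sadj p.1 p.2 * (x p.1 * x p.2) == -1]].

Let min_cond (F : {set {set S}}) :=
  (F \subset sedges S) && `[< balanced (del_edges F) >].

Let min_cond_sedges : min_cond (sedges S).
Proof.
rewrite /min_cond fintype.subxx; apply/asboolP => c /and3P[].
case: c => [|a [|b c]] //= _ _ /andP[]; rewrite /= /del_sadj.
case: ifP => // /negP ab sab; case: ab.
by apply/imsetP; exists (a, b).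
Qed.

Lemma frustration_le (x : S -> int) : (forall u, x u ^+ 2 = 1) ->
  (frustration S <= #|negative_edges x|)%N.
Proof.
move=> x2.
have nonneg (u v : S) : [set u; v]%SET \notin negative_edges x ->
    sadj u v != 0 -> sadj u v = x u * x v.
  move=> uv s0.
  have nuv : sadj u v * (x u * x v) != -1.
    by apply: contra uv => neg; apply/imsetP; exists (u, v); rewrite ?inE.
  have : x u = 1 \/ x u = -1.
    by have /eqP := x2 u; rewrite sqrf_eq1 => /orP[]/eqP ->; auto.
  have : x v = 1 \/ x v = -1.
    by have /eqP := x2 v; rewrite sqrf_eq1 => /orP[]/eqP ->; auto.
  move: (sadj_val u v) s0 nuv; rewrite !inE.
  by move=> /or3P[]/eqP -> // _ nuv [] xv [] xu; rewrite xv xu in nuv *.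
rewrite /frustration; case: arg_minnP => // F _; apply.
apply/andP; split.
  apply/fintype.subsetP => A /imsetP[[u v]]; rewrite inE /= => neg ->.
  apply/imsetP; exists (u, v) => //; rewrite inE /=.
  by apply: contraTneq neg => ->; rewrite mul0r.
apply/asboolP; apply: (@switch_balanced (del_edges (negative_edges x)) x) => //.
by move=> u v /=; rewrite /del_sadj; case: ifPn => // uv; apply: nonneg.
Qed.

(** The switching that makes an optimal deletion all-positive can have negative edges only among the
    deleted ones. *)
Lemma frustration_attained : exists x : S -> int,
  (forall u, x u ^+ 2 = 1) /\ (#|negative_edges x| <= frustration S)%N.
Proof.
rewrite /frustration; case: arg_minnP => // F /andP[_ /asboolP /balanced_switch].
move=> [x [x2 xs]] _; exists x; split=> //; apply: subset_leq_card.
apply/fintype.subsetP => A /imsetP[[u v]]; rewrite inE /= => neg ->.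
apply: contraLR neg => uvF; have := xs u v; rewrite /= /del_sadj (negPf uvF).
have [->|s0 ->//] := eqVneq (sadj u v) 0; first by rewrite mul0r.
by rewrite -expr2 exprMn !x2.
Qed.

Lemma card_negative_edges (x : S -> int) : (#|negative_edges x| * 2 =
  \sum_u \sum_v (sadj u v * (x u * x v) == -1)%R)%N.
Proof.
apply: card_unordered_pairs => [u v|u].
  by rewrite sadj_sym (mulrC (x u)).
by rewrite sadj_irrefl mul0r.
Qed.

End Frustration.

(** * Negative edges of the antisymmetric line graph, counted vertex by vertex *)

Section LineGraph.
Variables (G : sgraph) (o : orientation G).
Implicit Types (u v w : G) (e f : edge G).

Lemma mem_edges u v : ([set u; v]%SET \in edges G) = adj u v.
Proof.
apply/imsetP/idP => [[[x y]]|uv]; last by exists (u, v).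
rewrite inE /= => xy E.
have := in_set2 x u v; rewrite E !inE eqxx => /esym /orP[]/eqP xE.
  have := in_set2 y u v; rewrite E !inE eqxx orbT => /esym /orP[]/eqP yE.
    by rewrite xE yE adj_irrefl in xy.
  by rewrite -xE -yE.
have := in_set2 y u v; rewrite E !inE eqxx orbT => /esym /orP[]/eqP yE.
  by rewrite adj_sym -xE -yE.
by rewrite xE yE adj_irrefl in xy.
Qed.

Lemma adj_ends e : adj (tail o e) (head o e).
Proof. by rewrite -mem_edges -tail_head; exact: valP e. Qed.

Lemma tail_neq_head e : tail o e != head o e.
Proof. by apply: contraTneq (adj_ends e) => ->; rewrite adj_irrefl. Qed.

Lemma edge_ends e u v : val e = [set u; v]%SET ->
  (u = tail o e /\ v = head o e) \/ (u = head o e /\ v = tail o e).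
Proof.
move=> E; have th := tail_neq_head e; rewrite (tail_head o) in E.
have := in_set2 (tail o e) u v; rewrite -E !inE eqxx => /esym /orP[]/eqP tE.
  have := in_set2 (head o e) u v; rewrite -E !inE eqxx orbT.
  by case/esym/orP => /eqP hE; [rewrite tE hE eqxx in th | left].
have := in_set2 (head o e) u v; rewrite -E !inE eqxx orbT.
by case/esym/orP => /eqP hE; [right | rewrite tE hE eqxx in th].
Qed.

Definition incidence v e : int :=
  if v == head o e then 1 else if v == tail o e then -1 else 0.

Lemma antisym_line_sadjE e f : antisym_line_sadj o e f =
  \sum_v incidence v e * incidence v f - (e == f)%:R *+ 2.
Proof.
rewrite /antisym_line_sadj !mxE (inj_eq enum_rank_inj) -mulrnA mulnC mulrnA.
congr (_ - _); rewrite (reindex (@enum_val G G)) /=; last first.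
  by exists enum_rank => x _; rewrite ?enum_valK ?enum_rankK.
by apply: eq_bigr => i _; rewrite !mxE /incidence !enum_rankK.
Qed.

Lemma incidence_neq0 v e : (incidence v e != 0) = (v \in val e).
Proof.
rewrite (tail_head o) !inE /incidence orbC.
by case: (v == head o e) => //=; case: (v == tail o e).
Qed.

Lemma incidence_norm_sqr v e : `|incidence v e| ^+ 2 = incidence v e ^+ 2.
Proof. by rewrite /incidence; do 2?case: ifP. Qed.

(** Changes variables from the edges at [v] to the neighbours of [v]; simplicity of the graph makes
    this a bijection. *)
Lemma sum_incident (g : G -> int) v :
  \sum_e (if v == head o e then g (tail o e)
          else if v == tail o e then g (head o e) else 0) =
  \sum_(u | adj v u) g u.
Proof.
transitivity (\sum_(e : edge G) \sum_(u | adj v u) (val e == [set v; u]%SET)%:R * g u).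
  apply: eq_bigr => e _; have th := tail_neq_head e; have te := adj_ends e.
  have out u : u != tail o e -> u != head o e -> (val e == [set v; u]%SET) = false.
    move=> ut uh; apply/eqP => /edge_ends[][_ E]; first by rewrite E eqxx in uh.
    by rewrite E eqxx in ut.
  case: eqP => [vh|/eqP vh].
    rewrite (bigD1 (tail o e)) ?vh ?(adj_sym (head o e)) //=.
    rewrite (tail_head o) finset.setUC eqxx mul1r big1 ?addr0 // => u /andP[hu ut].
    rewrite finset.setUC -tail_head; have [uh|uh] := eqVneq u (head o e).
      by rewrite uh adj_irrefl in hu.
    by rewrite -vh out ?mul0r.
  case: eqP => [vt|/eqP vt].
    rewrite (bigD1 (head o e)) ?vt //= (tail_head o) eqxx mul1r.
    rewrite big1 ?addr0 // => u /andP[hu ut].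
    rewrite -tail_head; have [uh|uh] := eqVneq u (tail o e).
      by rewrite uh adj_irrefl in hu.
    by rewrite -vt out ?mul0r.
  rewrite big1 // => u _; case: eqP => [/edge_ends[][E _]|]; last by rewrite mul0r.
    by rewrite E eqxx in vt.
  by rewrite E eqxx in vh.
rewrite exchange_big; apply: eq_bigr => u vu; rewrite -mulr_suml.
have uvE : [set v; u]%SET \in edges G by rewrite mem_edges.
rewrite (bigD1 (exist (fun A => A \in edges G) _ uvE : edge G)) //= eqxx.
rewrite big1 ?addr0 ?mul1r // => e.
by move=> ne; case: eqP => // eE; case/eqP: ne; exact/val_inj.
Qed.

Lemma degreeE v : (degree v)%:R = \sum_u (adj v u)%:R :> int.
Proof.
rewrite /degree -sum1_card natr_sum big_mkcond; apply: eq_bigr => u _.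
by rewrite inE; case: (adj v u).
Qed.

Lemma sum_norm_incidence v : \sum_e `|incidence v e| = (degree v)%:R :> int.
Proof.
transitivity (\sum_(u | adj v u) (1 : int)); last first.
  by rewrite degreeE big_mkcond; apply: eq_bigr => u _; case: (adj v u).
rewrite -sum_incident; apply: eq_bigr => e _.
by rewrite /incidence; do 2?case: ifP.
Qed.

(** Distinct edges share at most one vertex, so the sum over vertices has at most one nonzero term
    and no cancellation. *)
Lemma norm_antisym_line_sadj e f : e != f ->
  `|antisym_line_sadj o e f| = \sum_v `|incidence v e| * `|incidence v f|.
Proof.
move=> ef; rewrite antisym_line_sadjE (negPf ef) mul0rn subr0.
have [v /andP[ve vf]|no] := pickP [pred v | (v \in val e) && (v \in val f)].
  have out u : u != v -> incidence u e * incidence u f = 0.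
    move=> uv; apply: contraNeq ef; rewrite mulf_eq0 negb_or !incidence_neq0.
    case/andP => ue uf; apply/eqP/val_inj.
    have two (g : edge G) : v \in val g -> u \in val g -> val g = [set u; v]%SET.
      rewrite (tail_head o g) !inE => /orP[]/eqP vE /orP[]/eqP uE.
      - by rewrite uE vE eqxx in uv.
      - by rewrite uE vE finset.setUC.
      - by rewrite uE vE.
      - by rewrite uE vE eqxx in uv.
    by rewrite (two e) // (two f).
  rewrite (bigD1 v) //= big1 // addr0 normrM.
  by rewrite [RHS](bigD1 v) //= big1 ?addr0 // => u /out; rewrite -normrM => ->.
have out u : incidence u e * incidence u f = 0.
  apply/eqP; have := no u; rewrite /= mulf_eq0 -!incidence_neq0.
  by do 2!case: eqP.
by rewrite big1 // normr0 big1 // => u _; rewrite -normrM out.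
Qed.

(** For s in {-1, 0, 1} and a sign t, twice the indicator of s t = -1 is |s| - s t. Summed over
    ordered pairs of edges, the two terms factor at each vertex into d(v)^2 and y(v)^2; the diagonal
    terms e = f cancel. *)
Lemma four_card_negative_edges (x : edge G -> int) : (forall e, x e ^+ 2 = 1) ->
  4 * #|negative_edges (x : antisym_line o -> int)|%:R =
  \sum_v ((degree v)%:R ^+ 2 - (\sum_e incidence v e * x e) ^+ 2) :> int.
Proof.
move=> x2.
have -> : 4 * #|negative_edges (x : antisym_line o -> int)|%:R =
  2 * (#|negative_edges (x : antisym_line o -> int)| * 2)%:R :> int.
  by rewrite natrM; ring.
rewrite card_negative_edges natr_sum mulr_sumr.
transitivity (\sum_e \sum_f \sum_v
    (`|incidence v e| * `|incidence v f|
     - incidence v e * x e * (incidence v f * x f))); last first.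
  under eq_bigr do rewrite exchange_big /=.
  rewrite exchange_big /=; apply: eq_bigr => v _.
  rewrite -sum_norm_incidence !expr2 !mulr_suml -sumrB; apply: eq_bigr => e _.
  by rewrite !mulr_sumr -sumrB.
apply: eq_bigr => e _; rewrite natr_sum mulr_sumr; apply: eq_bigr => f _ /=.
rewrite sumrB; have [->|ef] := eqVneq e f.
  rewrite antisym_line_sadj_irrefl mul0r -sumrB big1 // => v _.
  by rewrite -[in LHS]expr2 -[X in _ - X]expr2 exprMn x2 incidence_norm_sqr; ring.
rewrite -norm_antisym_line_sadj //.
have -> : \sum_v incidence v e * x e * (incidence v f * x f) =
    antisym_line_sadj o e f * (x e * x f).
  rewrite antisym_line_sadjE (negPf ef) mul0rn subr0 mulr_suml.
  by apply: eq_bigr => v _; ring.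
have : x e = 1 \/ x e = -1.
  by have /eqP := x2 e; rewrite sqrf_eq1 => /orP[]/eqP ->; auto.
have : x f = 1 \/ x f = -1.
  by have /eqP := x2 f; rewrite sqrf_eq1 => /orP[]/eqP ->; auto.
have := antisym_line_sadj_val o e f; rewrite !inE.
by move=> /or3P[]/eqP -> [] -> [] ->.
Qed.

End LineGraph.

(* A signed arc-function [b] encodes an orientation of the graph: [b u v] is 1 *)
(* if the edge [uv] points to [v] and -1 if it points to [u], so that          *)
(* [\sum_u b u v] is the in-degree minus the out-degree of [v].                *)
Definition sign_orientation (G : sgraph) (b : G -> G -> int) : Prop :=
  (forall u v, b v u = - b u v) /\ (forall u v, b u v ^+ 2 = (adj u v)%:R).

(** * Frustration index as a minimum over orientations of G *)

Section Orientation.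
Variables (G : sgraph) (o : orientation G).
Local Notation frust := (frustration (antisym_line o)).

Lemma sum_sign_orientation b v : sign_orientation b ->
  \sum_e incidence o v e * b (tail o e) (head o e) = \sum_u b u v.
Proof.
move=> [bN b2]; transitivity (\sum_(u | adj v u) b u v); last first.
  rewrite big_mkcond; apply: eq_bigr => u _; case: ifPn => // vu.
  by apply/esym/eqP; rewrite -sqrf_eq0 b2 adj_sym (negPf vu).
rewrite -(sum_incident o); apply: eq_bigr => e _; rewrite /incidence.
case: eqP => [->|_]; first by rewrite mul1r.
by case: eqP => [->|_]; rewrite ?mul0r // mulN1r -bN.
Qed.

Lemma frustration_le_orientation b : sign_orientation b ->
  4 * frust%:R <= \sum_(v : G) ((degree v)%:R ^+ 2 - (\sum_u b u v) ^+ 2) :> int.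
Proof.
move=> bO; have [_ b2] := bO.
pose x (e : edge G) := b (tail o e) (head o e).
have x2 e : x e ^+ 2 = 1 by rewrite b2 adj_ends.
under eq_bigr do rewrite -(sum_sign_orientation _ bO).
rewrite -(four_card_negative_edges o x2) ler_wpM2l // ler_nat.
exact: (@frustration_le (antisym_line o)).
Qed.

Lemma frustration_orientation : exists b : G -> G -> int, sign_orientation b /\
  \sum_(v : G) ((degree v)%:R ^+ 2 - (\sum_u b u v) ^+ 2) <= 4 * frust%:R.
Proof.
have [x [x2 xle]] := frustration_attained (antisym_line o).
(* The edge keeps its direction in [o] when its sign is 1 and is reversed when it is -1. *)
pose b (u v : G) : int :=
  if insub [set u; v]%SET is Some e then x e * incidence o v e else 0.
have bO : sign_orientation b.
  split=> u v; rewrite /b.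
    rewrite finset.setUC; case: insubP => [e _ eE|]; last by rewrite oppr0.
    rewrite -mulrN; congr (_ * _); have th := tail_neq_head o e.
    have [[-> ->]|[-> ->]] := edge_ends o eE; rewrite /incidence.
      by rewrite !eqxx (negPf th).
    by rewrite !eqxx (negPf th) opprK.
  rewrite -mem_edges; case: insubP => [e -> eE|/negPf -> //].
  rewrite exprMn x2 mul1r; have th := tail_neq_head o e.
  have [[_ ->]|[_ ->]] := edge_ends o eE; rewrite /incidence.
    by rewrite eqxx.
  by rewrite !eqxx (negPf th).
have xE e : x e = b (tail o e) (head o e).
  by rewrite /b -tail_head valK /incidence eqxx mulr1.
exists b; split=> //; under eq_bigr do rewrite -(sum_sign_orientation _ bO).
under eq_bigr do under eq_bigr do rewrite -xE.
by rewrite -(four_card_negative_edges o x2) ler_wpM2l // ler_nat.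
Qed.

End Orientation.

(** For in-degree k and out-degree l this says 4 min(k, l) <= 4 k l; the next lemma is the converse
    when k + l <= 2. *)
Lemma sqr_diff_ge (k l : nat) : 2 * (k%:R + l%:R) - 2 * `|k%:R - l%:R| <=
  (k%:R + l%:R) ^+ 2 - (k%:R - l%:R) ^+ 2 :> int.
Proof.
have -> : (k%:R + l%:R) ^+ 2 - (k%:R - l%:R) ^+ 2 = 4 * (k%:R * l%:R) :> int by ring.
rewrite !natz. case: k l => [|k] [|l]; nia.
Qed.
Lemma sqr_diff_le (k l : nat) : (k%:R + l%:R <= 2%:R :> int) ->
  (k%:R + l%:R) ^+ 2 - (k%:R - l%:R) ^+ 2 <=
  2 * (k%:R + l%:R) - 2 * `|k%:R - l%:R| :> int.
Proof.
have -> : (k%:R + l%:R) ^+ 2 - (k%:R - l%:R) ^+ 2 = 4 * (k%:R * l%:R) :> int by ring.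
rewrite !natz. case: k l => [|k] [|l]; nia.
Qed.

(** * Orientations against cuts: the defect bound and its exactness for degrees at most 2 *)

Section Cuts.
Variable G : sgraph.
Implicit Types (u v w : G) (S : {set G}).

Lemma sum_degree : \sum_(v : G) (degree v)%:R = 2 * #|edges G|%:R :> int.
Proof.
rewrite -natrM mulnC card_unordered_pairs; [|exact: adj_sym|exact: adj_irrefl].
by rewrite natr_sum; apply: eq_bigr => v _; rewrite natr_sum degreeE.
Qed.

Lemma cut_edgesE S : cut_edges S = [set [set p.1; p.2] | p in
  [pred p : G * G | adj p.1 p.2 && ((p.1 \in S) != (p.2 \in S))]]%SET.
Proof.
have cutE u v : u != v ->
    (#|[set u; v]%SET :&: S| == 1%N) = ((u \in S) != (v \in S)).
  move=> uv; rewrite finset.setIUl.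
  have I1 w : [set w]%SET :&: S = if w \in S then [set w]%SET else finset.set0.
    apply/finset.setP => z; rewrite !inE; case: ifP => wS; rewrite !inE.
      by case: eqP => // ->.
    by apply/negP => /andP[/eqP ->]; rewrite wS.
  rewrite !I1; case: (u \in S); case: (v \in S).
  - by rewrite cards2 uv.
  - by rewrite finset.setU0 cards1.
  - by rewrite finset.set0U cards1.
  - by rewrite finset.setU0 cards0.
apply/finset.setP => A; rewrite inE; apply/andP/imsetP.
  move=> [/imsetP[[u v]]]; rewrite inE /= => uv -> c1; exists (u, v) => //.
  rewrite inE /= uv -cutE //.
  by apply: contraTneq uv => ->; rewrite adj_irrefl.
move=> [[u v]]; rewrite inE /= => /andP[uv cut] ->; rewrite mem_edges uv cutE //.
by apply: contraTneq uv => ->; rewrite adj_irrefl.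
Qed.

Lemma card_cut_edges S : 2 * #|cut_edges S|%:R =
  \sum_u \sum_v (adj u v && ((u \in S) != (v \in S)))%:R :> int.
Proof.
pose r u v := adj u v && ((u \in S) != (v \in S)).
have rS : symmetric r by move=> u v; rewrite /r adj_sym eq_sym.
have rI : irreflexive r by move=> u; rewrite /r adj_irrefl.
rewrite cut_edgesE -natrM mulnC (card_unordered_pairs rS rI) natr_sum.
by apply: eq_bigr => u _; rewrite natr_sum.
Qed.

Definition side S v : int := if v \in S then 1 else -1.

(** Summation by parts: uncut edges contribute nothing, and a cut edge contributes according to
    whether it points into or out of [S]. *)
Lemma sum_side b S : sign_orientation b ->
  2 * (\sum_v side S v * \sum_u b u v) =
  \sum_u \sum_v b u v * (side S v - side S u).
Proof.
move=> [bN _].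
have E : \sum_v side S v * \sum_u b u v = \sum_u \sum_v b u v * side S v.
  rewrite exchange_big; apply: eq_bigr => v _; rewrite mulr_sumr.
  by apply: eq_bigr => u _; rewrite mulrC.
have E' : \sum_v side S v * \sum_u b u v = - \sum_u \sum_v b u v * side S u.
  rewrite -sumrN; apply: eq_bigr => v _; rewrite -mulr_suml -mulNr -sumrN mulrC.
  by congr (_ * _); apply: eq_bigr => u _; rewrite bN.
rewrite mulr2n mulrDl mul1r {1}E E' -sumrB; apply: eq_bigr => u _.
by rewrite -sumrB; apply: eq_bigr => v _; rewrite mulrBr.
Qed.

Lemma in_out_degree b v : sign_orientation b -> exists k l : nat,
  (degree v)%:R = k%:R + l%:R :> int /\ \sum_u b u v = k%:R - l%:R.
Proof.
move=> [bN b2].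
exists (\sum_u (b u v == 1)%R)%N, (\sum_u (b u v == -1)%R)%N.
rewrite degreeE !natr_sum -big_split -sumrB /=.
split; apply: eq_bigr => u _; have := b2 u v; rewrite adj_sym.
  case: (adj v u) => /eqP; first by rewrite sqrf_eq1 => /orP[]/eqP ->.
  by rewrite sqrf_eq0 => /eqP ->.
case: (adj v u) => /eqP; first by rewrite sqrf_eq1 => /orP[]/eqP ->.
by rewrite sqrf_eq0 => /eqP ->.
Qed.

Lemma maxcut_defect_le (o : orientation G) :
  (maxcut_defect G <= frustration (antisym_line o))%N.
Proof.
have [b [bO ble]] := frustration_orientation o; have [_ b2] := bO.
pose S := [set v | 0 <= \sum_u b u v]%SET.
have cutS : \sum_v `|\sum_u b u v| <= 2 * #|cut_edges S|%:R.
  have -> : \sum_v `|\sum_u b u v| = \sum_v side S v * \sum_u b u v.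
    apply: eq_bigr => v _; rewrite /side inE.
    case: ifPn => [y0|]; first by rewrite mul1r ger0_norm.
    by rewrite -ltNge => y0; rewrite mulN1r ltr0_norm.
  rewrite -(ler_pM2l (ltr0Sn _ 1)) sum_side // card_cut_edges mulr_sumr.
  apply: ler_sum => u _; rewrite mulr_sumr; apply: ler_sum => v _.
  have := b2 u v; rewrite /side; case: (adj u v) => /eqP; last first.
    by rewrite sqrf_eq0 => /eqP ->; rewrite mul0r.
  by rewrite sqrf_eq1 => /orP[]/eqP ->; case: (u \in S); case: (v \in S).
have cutm : (#|cut_edges S| <= maxcut G)%N by exact: leq_bigmax.
have : \sum_v (2 * (degree v)%:R - 2 * `|\sum_u b u v|) <=
    4 * (frustration (antisym_line o))%:R.
  apply: le_trans ble; apply: ler_sum => v _.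
  have [k [l [-> ->]]] := in_out_degree v bO; exact: sqr_diff_ge.
rewrite sumrB -!mulr_sumr sum_degree /maxcut_defect; move: (\sum_v `|_|) cutS => Y.
by rewrite !natz; lia.
Qed.

Lemma maxcut_defect_degree2 (o : orientation G) :
  (forall v, degree v <= 2)%N -> maxcut_defect G = frustration (antisym_line o).
Proof.
move=> d2; apply/eqP; rewrite eqn_leq maxcut_defect_le /=.
have set_gt0 : (0 < #|{: {set G}}|)%N by apply/card_gt0P; exists finset.set0.
have [S maxS] := bigop.eq_bigmax (fun S : {set G} => #|cut_edges S|) set_gt0.
(* Cut edges all point into the maximum cut [S]; the others are oriented by an arbitrary order of
   the vertices. *)
pose b u v : int := if adj u v then
    if (u \in S) != (v \in S) then side S v
    else if (enum_rank u < enum_rank v)%N then 1 else -1 else 0.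
have bO : sign_orientation b.
  split=> u v; rewrite /b.
    rewrite adj_sym; case: ifPn => uv; last by rewrite oppr0.
    rewrite eq_sym; case: eqP => [_|]; last first.
      by rewrite /side; case: (u \in S); case: (v \in S).
    case: ltngtP => // /ord_inj/enum_rank_inj uvE.
    by rewrite uvE adj_irrefl in uv.
  by rewrite /side; case: (adj u v) => //; do ![case: ifP => _].
have cutS : 2 * #|cut_edges S|%:R <= \sum_v `|\sum_u b u v|.
  apply: (@le_trans _ _ (\sum_v side S v * \sum_u b u v)); last first.
    apply: ler_sum => v _; apply: le_trans (ler_norm _) _.
    by rewrite normrM /side; case: (v \in S); rewrite ?normrN normr1 mul1r.
  rewrite -(ler_pM2l (ltr0Sn _ 1)) sum_side // card_cut_edges mulr_sumr.
  apply: ler_sum => u _; rewrite mulr_sumr; apply: ler_sum => v _.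
  rewrite /b /side; case: (adj u v); last by rewrite mul0r.
  by case: (u \in S); case: (v \in S); case: ifP.
have : 4 * (frustration (antisym_line o))%:R <=
    \sum_v (2 * (degree v)%:R - 2 * `|\sum_u b u v|).
  apply: le_trans (frustration_le_orientation o bO) _; apply: ler_sum => v _.
  have := d2 v; rewrite -(ler_nat int).
  have [k [l [-> ->]]] := in_out_degree v bO; exact: sqr_diff_le.
rewrite sumrB -!mulr_sumr sum_degree /maxcut_defect /maxcut maxS.
by move: (\sum_v `|_|) cutS => Y; rewrite !natz; lia.
Qed.

End Cuts.

(** * Laplacian eigenvalues and the spectral bound *)

Section LaplacianSpectrum.
Variables (R : realType) (G : sgraph).
Implicit Types (u v w : G) (f : G -> R) (a m : R).

Definition laplace f v : R :=
  (degree v)%:R * f v - \sum_u (adj u v)%:R * f u.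

(** Ordered pairs are summed, so this is twice the quadratic form of the Laplacian; hence the
    factors 2 in the bounds below. *)
Definition dirichlet f : R := \sum_u \sum_v (adj u v)%:R * (f u - f v) ^+ 2.

Lemma sum_enum_val (F : G -> R) : \sum_(i < #|G|) F (enum_val i) = \sum_v F v.
Proof.
rewrite (reindex (@enum_val G G)) //=.
by exists enum_rank => x _; rewrite ?enum_valK ?enum_rankK.
Qed.

Lemma mul_laplacian f : (\row_i f (enum_val i)) *m laplacian R G =
  \row_i laplace f (enum_val i).
Proof.
apply/rowP => j; rewrite mulmxBr mxE [X in _ + X]mxE mul_mx_diag !mxE.
rewrite /laplace mulrC -(sum_enum_val (fun u => (adj u _)%:R * f u)).
by congr (_ - _); apply: eq_bigr => i _; rewrite !mxE mulrC.
Qed.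

Lemma eigenvalue_laplacianP a : eigenvalue (laplacian R G) a <->
  exists f, (exists v, f v != 0) /\ forall v, laplace f v = a * f v.
Proof.
split=> [/eigenvalueP[y yE y0]|[f [[v fv] fE]]].
  pose f v := y 0 (enum_rank v).
  have yf : y = \row_i f (enum_val i).
    by apply/rowP => i; rewrite mxE /f enum_valK.
  exists f; split.
    have [i yi] : exists i, y 0 i != 0 by apply/rV0Pn.
    by exists (enum_val i); rewrite /f enum_valK.
  move=> v; move: yE; rewrite yf mul_laplacian => /rowP/(_ (enum_rank v)).
  by rewrite !mxE enum_rankK.
apply/eigenvalueP; exists (\row_i f (enum_val i)).
  by rewrite mul_laplacian; apply/rowP => i; rewrite !mxE fE.
apply/rV0Pn; exists (enum_rank v); by rewrite mxE enum_rankK.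
Qed.

Lemma natr_degree v : (degree v)%:R = \sum_u (adj u v)%:R :> R.
Proof.
have := congr1 (fun z : int => z%:~R : R) (degreeE v).
rewrite rmorph_nat => ->; rewrite rmorph_sum.
by apply: eq_bigr => u _; rewrite rmorph_nat adj_sym.
Qed.

Lemma sum_adj_degree (F : G -> R) :
  \sum_u \sum_v (adj u v)%:R * F v = \sum_v (degree v)%:R * F v.
Proof.
rewrite exchange_big; apply: eq_bigr => v _.
by rewrite -mulr_suml natr_degree.
Qed.

Lemma sum_laplace f : 2 * (\sum_v laplace f v * f v) = dirichlet f.
Proof.
have E : dirichlet f = 2 * (\sum_v (degree v)%:R * f v ^+ 2) -
    2 * (\sum_u \sum_v (adj u v)%:R * (f u * f v)).
  rewrite {1}[2 as X in X * \sum_v (degree v)%:R * _]mulr2n mulrDl mul1r.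
  rewrite -{1}sum_adj_degree.
  have -> : \sum_v (degree v)%:R * f v ^+ 2 =
      \sum_u \sum_v (adj u v)%:R * f u ^+ 2.
    rewrite -sum_adj_degree exchange_big; apply: eq_bigr => u _.
    by apply: eq_bigr => v _; rewrite adj_sym.
  rewrite -big_split mulr_sumr -sumrB; apply: eq_bigr => u _ /=.
  rewrite -big_split mulr_sumr -sumrB; apply: eq_bigr => v _ /=; ring.
rewrite E -mulrBr [\sum_u \sum_v _ * (_ * _)]exchange_big -sumrB.
congr (_ * _); apply: eq_bigr => v _; rewrite /laplace mulrBl mulr_suml -mulrA.
by rewrite -expr2; congr (_ - _); apply: eq_bigr => u _; rewrite mulrA.
Qed.

Lemma eigenvalue_laplacian_le m a :
  (forall f, dirichlet f <= 2 * m * \sum_v f v ^+ 2) ->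
  eigenvalue (laplacian R G) a -> a <= m.
Proof.
move=> dm /eigenvalue_laplacianP[f [[v fv] fE]].
have f2 : 0 < \sum_v f v ^+ 2.
  rewrite (bigD1 v) //= ltr_pwDl ?exprn_even_gt0 //.
  by apply: sumr_ge0 => u _; exact: sqr_ge0.
have := dm f; rewrite -sum_laplace.
under eq_bigr do rewrite fE -mulrA -expr2.
by rewrite -mulr_sumr mulrA ler_pM2r // ler_pM2l.
Qed.

(** The energy grows when all pairs are made adjacent, and for the complete graph it is 2 n sum f^2
    - 2 (sum f)^2. *)
Lemma dirichlet_le_card f : dirichlet f <= 2 * #|G|%:R * \sum_v f v ^+ 2.
Proof.
have E : \sum_u \sum_v (f u - f v) ^+ 2 =
    2 * #|G|%:R * (\sum_v f v ^+ 2) - 2 * (\sum_v f v) ^+ 2.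
  rewrite -mulrA mulr2n mulrDl mul1r mulrDl mul1r.
  have n1 : #|G|%:R * (\sum_v f v ^+ 2) = \sum_(u : G) \sum_v f v ^+ 2.
    by rewrite sumr_const mulr_natl.
  have n2 : #|G|%:R * (\sum_v f v ^+ 2) = \sum_u \sum_(v : G) f u ^+ 2.
    by rewrite n1 exchange_big.
  rewrite {1}n1 n2 expr2 mulr_suml -!big_split -sumrB; apply: eq_bigr => u _ /=.
  rewrite mulr_sumr -!big_split -sumrB; apply: eq_bigr => v _ /=; ring.
apply: (@le_trans _ _ (\sum_u \sum_v (f u - f v) ^+ 2)); last first.
  by rewrite E lerBlDr lerDl mulr_ge0 // sqr_ge0.
apply: ler_sum => u _; apply: ler_sum => v _.
by case: (adj u v); rewrite ?mul1r ?mul0r ?sqr_ge0.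
Qed.

Lemma dirichlet_le_degree (d : nat) f : (forall v, degree v <= d)%N ->
  dirichlet f <= 2 * (2 * d)%:R * \sum_v f v ^+ 2.
Proof.
move=> dd.
have E : 4 * (\sum_v (degree v)%:R * f v ^+ 2) =
    \sum_u \sum_v (adj u v)%:R * (2 * f u ^+ 2 + 2 * f v ^+ 2).
  have -> : \sum_u \sum_v (adj u v)%:R * (2 * f u ^+ 2 + 2 * f v ^+ 2) =
      2 * (\sum_u \sum_v (adj u v)%:R * f u ^+ 2) +
      2 * (\sum_u \sum_v (adj u v)%:R * f v ^+ 2).
    rewrite !mulr_sumr -big_split; apply: eq_bigr => u _ /=.
    rewrite !mulr_sumr -big_split; apply: eq_bigr => v _ /=; ring.
  have -> : \sum_u \sum_v (adj u v)%:R * f u ^+ 2 =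
      \sum_u \sum_v (adj u v)%:R * f v ^+ 2.
    rewrite exchange_big; apply: eq_bigr => u _; apply: eq_bigr => v _.
    by rewrite adj_sym.
  by rewrite sum_adj_degree; ring.
apply: (@le_trans _ _ (4 * (\sum_v (degree v)%:R * f v ^+ 2))).
  rewrite E; apply: ler_sum => u _; apply: ler_sum => v _.
  rewrite ler_wpM2l // -subr_ge0.
  have -> : 2 * f u ^+ 2 + 2 * f v ^+ 2 - (f u - f v) ^+ 2 = (f u + f v) ^+ 2.
    by ring.
  exact: sqr_ge0.
rewrite natrM mulrA -mulrA -natrM ler_wpM2l // mulr_sumr.
by apply: ler_sum => v _; rewrite ler_wpM2r ?sqr_ge0 // ler_nat.
Qed.

Lemma has_ubound_eigenvalue :
  has_ubound [set a | eigenvalue (laplacian R G) a]%classic.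
Proof.
exists #|G|%:R => a /=; apply: eigenvalue_laplacian_le; exact: dirichlet_le_card.
Qed.

Lemma eigenvalue_le_lambda_max a :
  eigenvalue (laplacian R G) a -> a <= lambda_max R G.
Proof. by move=> ea; apply: ub_le_sup => //; exact: has_ubound_eigenvalue. Qed.

Lemma eigenvalue_laplacian0 : (0 < #|G|)%N -> eigenvalue (laplacian R G) 0.
Proof.
move=> /card_gt0P[v _]; apply/eigenvalue_laplacianP; exists (fun=> 1).
split; first by exists v; rewrite oner_eq0.
by move=> u; rewrite /laplace mul0r -mulr_suml -natr_degree subrr.
Qed.

Lemma lambda_max_le m : (0 < #|G|)%N ->
  (forall f, dirichlet f <= 2 * m * \sum_v f v ^+ 2) -> lambda_max R G <= m.
Proof.
move=> G0 dm; apply: ge_sup; first by exists 0; exact: eigenvalue_laplacian0.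
by move=> a; exact: eigenvalue_laplacian_le.
Qed.

Lemma dirichlet_le_lambda_max f :
  dirichlet f <= 2 * lambda_max R G * \sum_v f v ^+ 2.
Proof.
have lapT : (laplacian R G)^T = laplacian R G.
  apply/matrixP => i j; rewrite !mxE adj_sym eq_sym; congr (_ - _).
  by case: eqP => // ->.
have := rayleigh_le lapT eigenvalue_le_lambda_max (\row_i f (enum_val i)).
rewrite mul_laplacian -sum_laplace -mulrA ler_pM2l //.
rewrite [X in X <= _]mxE [X in _ <= _ * X]mxE.
rewrite -(sum_enum_val (fun v => laplace f v * f v)).
rewrite -(sum_enum_val (fun v => f v ^+ 2)) => H.
move: H; under eq_bigr do rewrite !mxE.
by under [X in _ <= _ * X -> _]eq_bigr do rewrite !mxE -expr2.
Qed.

Lemma sum_degree_real : \sum_(v : G) (degree v)%:R = 2 * #|edges G|%:R :> R.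
Proof.
have := congr1 (fun z : int => z%:~R : R) (sum_degree G).
rewrite rmorphM !rmorph_nat => <-; rewrite rmorph_sum.
by apply: eq_bigr => u _; rewrite rmorph_nat.
Qed.

(* Applies 0 <= |t d(y) - b|^2, where d(y) is the coboundary of the imbalance *)
(* y of b, with t = 1 / lambda_max.                                           *)
Lemma sum_imbalance_sqr_le (b : G -> G -> int) : sign_orientation b ->
  \sum_v ((\sum_u b u v) ^+ 2)%:~R <= #|edges G|%:R * lambda_max R G.
Proof.
move=> [bN b2]; pose y v : R := (\sum_u b u v)%:~R.
have -> : \sum_v ((\sum_u b u v) ^+ 2)%:~R = \sum_v y v ^+ 2.
  by apply: eq_bigr => v _; rewrite rmorphXn.
set Y := \sum_v y v ^+ 2; set lam := lambda_max R G.
have Y0 : 0 <= Y by apply: sumr_ge0 => v _; exact: sqr_ge0.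
have E2 : \sum_(u : G) \sum_v (adj u v)%:R = 2 * #|edges G|%:R :> R.
  rewrite -sum_degree_real; apply: eq_bigr => v _; rewrite natr_degree.
  by apply: eq_bigr => u _; rewrite adj_sym.
have YE : \sum_u \sum_v (b u v)%:~R * (y v - y u) = 2 * Y.
  have Y1 : Y = \sum_u \sum_v (b u v)%:~R * y v.
    rewrite exchange_big; apply: eq_bigr => v _.
    by rewrite -mulr_suml -rmorph_sum expr2.
  have Y2 : Y = - \sum_u \sum_v (b u v)%:~R * y u.
    rewrite {1}Y1 exchange_big -sumrN; apply: eq_bigr => u _; rewrite -sumrN.
    by apply: eq_bigr => v _; rewrite bN rmorphN mulNr.
  rewrite mulr2n mulrDl mul1r {1}Y1 Y2 -sumrB; apply: eq_bigr => u _.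
  by rewrite -sumrB; apply: eq_bigr => v _; rewrite mulrBr.
have quad t : 0 <= t ^+ 2 * dirichlet y - 4 * t * Y + 2 * #|edges G|%:R.
  have -> : t ^+ 2 * dirichlet y - 4 * t * Y + 2 * #|edges G|%:R =
      \sum_u \sum_v (t * (adj u v)%:R * (y v - y u) - (b u v)%:~R) ^+ 2.
    have -> : 4 * t * Y = 2 * t * (2 * Y) by ring.
    rewrite -E2 -YE !mulr_sumr -sumrB -big_split; apply: eq_bigr => u _ /=.
    rewrite !mulr_sumr -sumrB -big_split; apply: eq_bigr => v _ /=.
    have := congr1 (fun z : int => z%:~R : R) (b2 u v).
    rewrite rmorphXn rmorph_nat /=; case: (adj u v) => b2'.
      by rewrite [RHS]sqrrB b2' /=; ring.
    by move/eqP: b2'; rewrite sqrf_eq0 => /eqP -> /=; ring.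
  by apply: sumr_ge0 => u _; apply: sumr_ge0 => v _; exact: sqr_ge0.
have quad' t : 0 <= t ^+ 2 * (lam * Y) - 2 * t * Y + #|edges G|%:R.
  have := dirichlet_le_lambda_max y; rewrite -/lam -/Y => D.
  have := ler_wpM2l (sqr_ge0 t) D; have := quad t; lra.
have e0 : 0 <= #|edges G|%:R :> R by [].
case: (posnP #|G|) => [G0|G0].
  rewrite /Y big_pred0 => [|v]; last by have := fintype0 v G0.
  have -> : #|edges G|%:R = 0 :> R; last by rewrite mul0r.
  apply: (@mulfI _ 2) => //; rewrite mulr0 -sum_degree_real big_pred0 // => v.
  by have := fintype0 v G0.
have lam0 : 0 <= lam := eigenvalue_le_lambda_max (eigenvalue_laplacian0 G0).
move: lam0; rewrite le0r => /orP[/eqP lam0|lam_gt0].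
  rewrite lam0 mulr0 leNgt; apply/negP => Y_gt0.
  (* With [lam] = 0 the quadratic in t is the linear function |E| - 2 t Y, and this t makes it
     -1. *)
  have := quad' ((#|edges G|%:R + 1) / (2 * Y)).
  rewrite lam0 mul0r mulr0 add0r.
  have -> : 2 * ((#|edges G|%:R + 1) / (2 * Y)) * Y = #|edges G|%:R + 1.
    by field; rewrite gt_eqF.
  lra.
have := quad' lam^-1.
have -> : lam^-1 ^+ 2 * (lam * Y) - 2 * lam^-1 * Y = - (Y / lam).
  by field; rewrite gt_eqF.
by rewrite addrC subr_ge0 ler_pdivrMr.
Qed.

Lemma spec_le (o : orientation G) :
  spec R G <= (frustration (antisym_line o))%:R.
Proof.
have [b [bO ble]] := frustration_orientation o.
rewrite /spec ler_pdivrMr // mulrC natr_sum.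
have := sum_imbalance_sqr_le bO; move: ble; rewrite -(ler_int R).
rewrite rmorphM !rmorph_nat rmorph_sum /=.
under eq_bigr do rewrite rmorphB rmorphXn rmorph_nat /=.
rewrite sumrB.
under [X in _ -> X - _ <= _]eq_bigr do rewrite natrX.
lra.
Qed.

End LaplacianSpectrum.

(** * Triangles as a lower bound for in-out paths *)

Section Triangles.
Variable G : sgraph.
Implicit Types (u v w : G).

Definition triangle u v w : int :=
  (adj u v)%:R * (adj v w)%:R * (adj w u)%:R.

Definition ordered_triangles : int := \sum_u \sum_v \sum_w triangle u v w.

(** For [b] a signed orientation, this is 2 when u, v, w is a path with one arc entering and one
    leaving the middle vertex [v], and 0 otherwise. *)
Definition path_deficit (b : G -> G -> int) u v w : int :=
  (adj u v)%:R * (adj w v)%:R - b u v * b w v.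

Lemma sum_path_deficit b :
  \sum_v ((degree v)%:R ^+ 2 - (\sum_u b u v) ^+ 2) =
  \sum_u \sum_v \sum_w path_deficit b u v w.
Proof.
rewrite exchange_big; apply: eq_bigr => v _; rewrite degreeE.
have -> : \sum_u (adj v u)%:R = \sum_u (adj u v)%:R :> int.
  by apply: eq_bigr => u _; rewrite adj_sym.
rewrite !expr2 !mulr_suml -sumrB; apply: eq_bigr => u _.
by rewrite !mulr_sumr -sumrB.
Qed.

Lemma path_deficit_ge0 b u v w : sign_orientation b -> 0 <= path_deficit b u v w.
Proof.
move=> [_ b2]; rewrite /path_deficit; have := b2 u v; have := b2 w v.
case: (adj u v); case: (adj w v) => /eqP + /eqP.
- by rewrite !sqrf_eq1 => /orP[]/eqP -> /orP[]/eqP ->.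
- by rewrite !sqrf_eq0 => /eqP -> _; rewrite !mulr0.
- by rewrite !sqrf_eq0 => _ /eqP ->; rewrite !mul0r.
- by rewrite !sqrf_eq0 => _ /eqP ->; rewrite !mul0r.
Qed.

Lemma sum_rotate (F : G -> G -> G -> int) :
  \sum_u \sum_v \sum_w F v w u = \sum_u \sum_v \sum_w F u v w.
Proof. by rewrite exchange_big; apply: eq_bigr => v _; rewrite exchange_big. Qed.

Lemma triangle_rot u v w : triangle v w u = triangle u v w.
Proof. by rewrite /triangle mulrC mulrA. Qed.

(** Rotating the triple permutes the three corners of a triangle, so the deficit can be gathered
    triangle by triangle. *)
Lemma sum_triangle_deficit b :
  3 * (\sum_u \sum_v \sum_w triangle u v w * path_deficit b u v w) =
  \sum_u \sum_v \sum_w triangle u v w * (path_deficit b u v w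
    + path_deficit b v w u + path_deficit b w u v).
Proof.
pose F u v w := triangle u v w * path_deficit b u v w.
have E1 : \sum_u \sum_v \sum_w triangle u v w * path_deficit b v w u =
    \sum_u \sum_v \sum_w F u v w.
  rewrite -(sum_rotate F); apply: eq_bigr => u _; apply: eq_bigr => v _.
  by apply: eq_bigr => w _; rewrite /F (triangle_rot u v w).
have E2 : \sum_u \sum_v \sum_w triangle u v w * path_deficit b w u v =
    \sum_u \sum_v \sum_w F u v w.
  rewrite -(sum_rotate F) -(sum_rotate (fun u v w => F v w u)).
  apply: eq_bigr => u _; apply: eq_bigr => v _.
  by apply: eq_bigr => w _; rewrite /F -(triangle_rot w u v).
transitivity (\sum_u \sum_v \sum_w F u v w
  + \sum_u \sum_v \sum_w triangle u v w * path_deficit b v w u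
  + \sum_u \sum_v \sum_w triangle u v w * path_deficit b w u v).
  by rewrite E1 E2 /F; ring.
rewrite -!big_split; apply: eq_bigr => u _ /=.
rewrite -!big_split; apply: eq_bigr => v _ /=.
by rewrite -!big_split; apply: eq_bigr => w _ /=; rewrite /F !mulrDr.
Qed.

(* In a triangle the products of the signs at the three corners multiply to    *)
(* -1, so at least one corner has one arc in and one arc out.                  *)
Lemma ordered_triangles_le (b : G -> G -> int) : sign_orientation b ->
  2 * ordered_triangles <=
  3 * \sum_v ((degree v)%:R ^+ 2 - (\sum_u b u v) ^+ 2).
Proof.
move=> bO; have [bN b2] := bO; rewrite sum_path_deficit.
apply: (@le_trans _ _
    (3 * (\sum_u \sum_v \sum_w triangle u v w * path_deficit b u v w))); last first.
  rewrite ler_wpM2l //; apply: ler_sum => u _; apply: ler_sum => v _.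
  apply: ler_sum => w _; rewrite ler_piMl ?path_deficit_ge0 //.
  by rewrite /triangle; case: (adj u v); case: (adj v w); case: (adj w u).
rewrite sum_triangle_deficit mulr_sumr; apply: ler_sum => u _.
rewrite mulr_sumr; apply: ler_sum => v _.
rewrite mulr_sumr; apply: ler_sum => w _.
rewrite /triangle /path_deficit.
rewrite (bN v w) (bN w u) (bN u v) (adj_sym v u) (adj_sym w v) (adj_sym u w).
have := b2 u v; have := b2 v w; have := b2 w u.
case: (adj u v); last by rewrite !mul0r.
case: (adj v w); last by rewrite mulr0 !mul0r.
case: (adj w u); last by rewrite !mulr0 !mul0r.
move=> /eqP + /eqP + /eqP; rewrite !sqrf_eq1.
by move=> /orP[]/eqP -> /orP[]/eqP -> /orP[]/eqP ->.
Qed.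

End Triangles.

(** * Complete multipartite graphs: the orientation along an order of the parts *)

Section Multipartite.
Variable G : sgraph.
Variables (I : finType) (part : G -> I).
Hypothesis adjE : forall u v : G, adj u v = (part u != part v).
Implicit Types (u v w : G).

Let rank v : nat := enum_rank (part v).

Let rankE u v : (rank u == rank v) = (part u == part v).
Proof. by rewrite /rank (inj_eq (@ord_inj _)) (inj_eq enum_rank_inj). Qed.

Definition part_orientation u v : int :=
  if (rank u < rank v)%N then 1 else if (rank v < rank u)%N then -1 else 0.

Lemma part_orientationP : sign_orientation part_orientation.
Proof.
split=> u v; rewrite /part_orientation.
  by case: ltngtP => _; rewrite ?oppr0 ?opprK.
by rewrite adjE -rankE; case: ltngtP.
Qed.

(** Equality case of [ordered_triangles_le]: ranks increase strictly along an in-out path, so its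
    ends are adjacent, and each triangle is transitive with exactly one in-out corner. *)
Lemma part_orientation_triangles :
  3 * \sum_v ((degree v)%:R ^+ 2 - (\sum_u part_orientation u v) ^+ 2) =
  2 * ordered_triangles G.
Proof.
rewrite sum_path_deficit.
transitivity (3 * (\sum_u \sum_v \sum_w triangle u v w *
   path_deficit part_orientation u v w)).
  congr (_ * _); apply: eq_bigr => u _; apply: eq_bigr => v _.
  apply: eq_bigr => w _.
  rewrite /triangle /path_deficit !adjE -!rankE /part_orientation.
  by case: (ltngtP (rank u) (rank v)); case: (ltngtP (rank v) (rank w));
    case: (ltngtP (rank w) (rank u)) => //=; lia.
rewrite sum_triangle_deficit mulr_sumr; apply: eq_bigr => u _.
rewrite mulr_sumr; apply: eq_bigr => v _.
rewrite mulr_sumr; apply: eq_bigr => w _.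
rewrite /triangle /path_deficit !adjE -!rankE /part_orientation.
by case: (ltngtP (rank u) (rank v)); case: (ltngtP (rank v) (rank w));
  case: (ltngtP (rank w) (rank u)) => //=; lia.
Qed.

End Multipartite.

(** * Complete multipartite graphs: frustration index and spectrum *)

Section MultipartiteSpectrum.
Variables (G : sgraph) (I : finType) (part : G -> I).
Hypothesis adjE : forall u v : G, adj u v = (part u != part v).
Implicit Types (u v w : G).

Lemma frustration_multipartite (o : orientation G) :
  6 * (frustration (antisym_line o))%:R = ordered_triangles G.
Proof.
have [b [bO bl]] := frustration_orientation o.
have := frustration_le_orientation o (part_orientationP adjE).
have := ordered_triangles_le bO; have := part_orientation_triangles adjE.
lra.
Qed.

(** For an edge uv every w is adjacent to u or to v, so with a, b the two adjacency indicators (1 -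
    a)(1 - b) = 0, that is a + b - 1 = a b. Summing over u, v, w gives the identity. *)
Lemma sum_degree_multipartite :
  2 * (\sum_(v : G) (degree v)%:R ^+ 2) - #|G|%:R * (\sum_(v : G) (degree v)%:R) =
  ordered_triangles G.
Proof.
have aS (u : G) : (degree u)%:R = \sum_w (adj w u)%:R :> int.
  by rewrite degreeE; apply: eq_bigr => w _; rewrite adj_sym.
have d1 : \sum_(v : G) (degree v)%:R ^+ 2 =
    \sum_(u : G) \sum_v \sum_w (adj u v)%:R * (adj w u)%:R :> int.
  apply: eq_bigr => u _; rewrite expr2 {1}degreeE aS mulr_suml.
  by apply: eq_bigr => v _; rewrite mulr_sumr.
have d2 : \sum_(v : G) (degree v)%:R ^+ 2 =
    \sum_(u : G) \sum_v \sum_w (adj u v)%:R * (adj v w)%:R :> int.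
  rewrite exchange_big; apply: eq_bigr => v _; rewrite expr2 {1}aS degreeE.
  by rewrite mulr_suml; apply: eq_bigr => u _; rewrite mulr_sumr.
have d3 : #|G|%:R * (\sum_(v : G) (degree v)%:R) =
    \sum_(u : G) \sum_v \sum_(w : G) (adj u v)%:R :> int.
  rewrite mulr_sumr; apply: eq_bigr => u _; rewrite degreeE mulr_sumr.
  by apply: eq_bigr => v _; rewrite sumr_const mulr_natl.
rewrite mulr2n mulrDl mul1r {1}d1 d2 d3 -big_split -sumrB.
apply: eq_bigr => u _ /=; rewrite -big_split -sumrB.
apply: eq_bigr => v _ /=; rewrite -big_split -sumrB.
apply: eq_bigr => w _ /=; rewrite /triangle !adjE.
case: (eqVneq (part u) (part v)) => [->|uv] /=; first by rewrite !mul0r.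
have : (part v != part w) || (part w != part u).
  by rewrite -negb_and; apply: contra uv => /andP[/eqP -> /eqP ->].
by case: (part v != part w); case: (part w != part u).
Qed.

Variable R : realType.

Lemma lambda_max_multipartite (x y : G) : adj x y -> lambda_max R G = #|G|%:R.
Proof.
move=> xy; apply/eqP; rewrite eq_le lambda_max_le /=; first last.
- by move=> f; exact: dirichlet_le_card.
- by apply/card_gt0P; exists x.
apply: eigenvalue_le_lambda_max; apply/eigenvalue_laplacianP.
pose size_of i : R := \sum_u (part u == i)%:R.
(* Constant on each part and with zero total sum, such a function is an eigenvector for |G|; the
   weights are the sizes of the opposite parts. *)
pose f v : R := (part v == part x)%:R * size_of (part y)
  - (part v == part y)%:R * size_of (part x).
have xy' : part x != part y by rewrite -adjE.
exists f; split.
  exists x; rewrite /f eqxx (negPf xy') mul1r mul0r subr0 gt_eqF //.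
  rewrite /size_of (bigD1 y) //= eqxx ltr_pwDl //.
  by apply: sumr_ge0 => u _.
move=> v; have aE (u : G) : (adj u v)%:R = 1 - (part u == part v)%:R :> R.
  by rewrite adjE; case: eqP => _; rewrite ?subrr ?subr0.
have sum0 : \sum_u f u = 0.
  by rewrite sumrB -!mulr_suml -!/(size_of _) mulrC subrr.
have dE : (degree v)%:R = #|G|%:R - size_of (part v).
  rewrite natr_degree; under eq_bigr do rewrite aE.
  by rewrite sumrB sumr_const.
have nE : \sum_u (adj u v)%:R * f u = - (size_of (part v) * f v).
  transitivity (\sum_u f u - \sum_u (part u == part v)%:R * f v).
    rewrite -sumrB; apply: eq_bigr => u _; rewrite aE mulrBl mul1r.
    by congr (_ - _); case: eqP => [E|_]; rewrite ?mul0r // /f E.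
  by rewrite sum0 sub0r -mulr_suml.
by rewrite /laplace dE nE; ring.
Qed.

Lemma spec_multipartite :
  4 * spec R G = \sum_(v : G) (degree v)%:R ^+ 2 - #|edges G|%:R * #|G|%:R.
Proof.
rewrite /spec mulrC divfK // natr_sum; congr (_ - _).
  by apply: eq_bigr => v _; rewrite natrX.
have [->|[A /imsetP[[x y]]]] := set_0Vmem (edges G).
  by rewrite cards0 !mul0r.
by rewrite inE /= => xy _; rewrite (lambda_max_multipartite xy).
Qed.

Lemma spec_frustration_multipartite (o : orientation G) :
  spec R G = 3 / 4 * (frustration (antisym_line o))%:R.
Proof.
have tE := sum_degree_multipartite; rewrite -(frustration_multipartite o) in tE.
have {tE} := congr1 (fun z : int => z%:~R : R) tE.
rewrite rmorphB !rmorphM !rmorph_nat /= !rmorph_sum /=.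
under eq_bigr do rewrite rmorphXn rmorph_nat /=.
under [X in _ - _ * X = _ -> _]eq_bigr do rewrite rmorph_nat /=.
rewrite sum_degree_real; have := spec_multipartite.
lra.
Qed.

End MultipartiteSpectrum.

(** * Complete graphs, as multipartite graphs with singleton parts *)

Section CompleteGraph.
Variable n : nat.

Definition complete_adj (i j : 'I_n) : bool := i != j.

Lemma complete_adj_sym : symmetric complete_adj.
Proof. by move=> i j; rewrite /complete_adj eq_sym. Qed.

Lemma complete_adj_irrefl : irreflexive complete_adj.
Proof. by move=> i; rewrite /complete_adj eqxx. Qed.

Definition complete_graph : sgraph := SGraph complete_adj_sym complete_adj_irrefl.

Lemma complete_graph_degree (i : complete_graph) : degree i = n.-1.
Proof.
rewrite /degree -[n in RHS]card_ord -(cardC1 i); apply: eq_card => j.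
by rewrite !inE eq_sym.
Qed.

Lemma complete_graph_edges (R : realType) :
  2 * #|edges complete_graph|%:R = n%:R * n.-1%:R :> R.
Proof.
rewrite -sum_degree_real; under eq_bigr do rewrite complete_graph_degree.
by rewrite sumr_const card_ord mulr_natl.
Qed.

Lemma spec_complete_graph (R : realType) :
  8 * spec R complete_graph = n%:R * n.-1%:R * (2 * n.-1%:R - n%:R).
Proof.
have := @spec_multipartite complete_graph _ id (fun _ _ => erefl) R.
under eq_bigr do rewrite complete_graph_degree.
rewrite sumr_const card_ord -mulr_natl => s4.
have := complete_graph_edges R; nra.
Qed.

End CompleteGraph.

(** * Cycles and the decay of the spectral bound *)

Section CycleGraph.

Lemma val_ordS n (i : 'I_n) : ordS i = (if i.+1 == n then 0 else i.+1)%N :> nat.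
Proof.
rewrite /=; have := ltn_ord i; rewrite leq_eqVlt => /orP[/eqP ->|lt_in].
  by rewrite eqxx modnn.
by rewrite modn_small // ltn_eqF.
Qed.

Lemma val_ord_pred n (i : 'I_n) :
  ord_pred i = (if i == 0 :> nat then n.-1 else i.-1)%N :> nat.
Proof.
rewrite /=; have := ltn_ord i; case: (nat_of_ord i) => [|j] lt_jn /=.
  by rewrite add0n modn_small // prednK.
by rewrite modnDr modn_small // ltnW.
Qed.

Lemma cycle_graph_degree_le n (i : cycle_graph n) : (degree i <= 2)%N.
Proof.
apply: (@leq_trans #|[set ordS i; ord_pred i]%SET|).
  apply: subset_leq_card; apply/fintype.subsetP => j; rewrite !inE.
  move=> /andP[_ /orP[/eqP <-|/eqP <-]]; first by rewrite eqxx.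
  by rewrite ordSK eqxx orbT.
by rewrite cards2; case: (_ != _).
Qed.

Lemma sum_adj_cycle_graph (R : realType) n (i : cycle_graph n.+3)
    (F : cycle_graph n.+3 -> R) :
  \sum_j (adj j i)%:R * F j = F (ordS i) + F (ord_pred i).
Proof.
have lti := ltn_ord i; have Sv := val_ordS i; have Pv := val_ord_pred i.
have SP : ord_pred i != ordS i.
  apply/eqP => /(congr1 val) /=; rewrite -[LHS]/(nat_of_ord (ord_pred i)).
  rewrite -[RHS]/(nat_of_ord (ordS i)) Sv Pv.
  by do 2!case: eqP; lia.
have Si : ordS i != i.
  by apply/eqP => /(congr1 (@nat_of_ord _)); rewrite Sv; case: eqP; lia.
have Pi : ord_pred i != i.
  by apply/eqP => /(congr1 (@nat_of_ord _)); rewrite Pv; case: eqP; lia.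
rewrite (bigD1 (ordS i)) //= (bigD1 (ord_pred i)) //= big1 => [|j /andP[jS jP]].
  by rewrite /cycle_adj Si Pi ord_predK !eqxx orbT /= !mul1r addr0.
rewrite /cycle_adj (eq_sym (ordS i)) (negPf jS) orbF.
have [jE|_] := eqVneq (ordS j) i; last by rewrite andbF mul0r.
by rewrite -jE ordSK eqxx in jP.
Qed.

Variable R : realType.

Lemma natr_degree_cycle_graph n (i : cycle_graph n.+3) : (degree i)%:R = 2 :> R.
Proof.
rewrite natr_degree; under eq_bigr do rewrite -[_%:R]mulr1.
by rewrite (sum_adj_cycle_graph i (fun=> 1)).
Qed.

Lemma spec_cycle_graph n :
  spec R (cycle_graph n.+3) = n.+3%:R * (4 - lambda_max R (cycle_graph n.+3)) / 4.
Proof.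
have E : #|edges (cycle_graph n.+3)|%:R = n.+3%:R :> R.
  apply: (@mulfI _ 2) => //; rewrite -sum_degree_real.
  under eq_bigr do rewrite natr_degree_cycle_graph.
  by rewrite sumr_const card_ord mulr_natr.
rewrite /spec E natr_sum; congr (_ / _).
under eq_bigr do rewrite natrX natr_degree_cycle_graph.
by rewrite sumr_const card_ord -mulr_natl; ring.
Qed.

Lemma spec_cycle_graph_ge0 n : 0 <= spec R (cycle_graph n.+3).
Proof.
rewrite spec_cycle_graph divr_ge0 // mulr_ge0 // subr_ge0 lambda_max_le //.
  by rewrite card_ord.
move=> f; have := dirichlet_le_degree f (@cycle_graph_degree_le n.+3).
by rewrite (_ : (2 * 2)%:R = 4 :> R).
Qed.

Section OddCycle.
Variable k : nat.
Let n := k.*2.+3.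

(** As n is odd, the sign change of (-1)^j over one turn cancels that of the cosine, so the wave is
    n-periodic. *)
Let wave (j : nat) : R := (-1) ^+ j * cos (j%:R * (pi / n%:R)).

Let waveDn j : wave (j + n) = wave j.
Proof.
have nx : n%:R * (pi / n%:R) = pi :> R by rewrite mulrC divfK // pnatr_eq0.
rewrite /wave exprD natrD mulrDl nx cosDpi.
have -> : (-1) ^+ n = -1 :> R by rewrite -signr_odd /= odd_double.
by ring.
Qed.

Let wave_mod j : wave (j %% n) = wave j.
Proof.
rewrite [in RHS](divn_eq j n); elim: (j %/ n)%N => [|q IHq]; first by rewrite add0n.
by rewrite mulSnr addnAC waveDn.
Qed.

Let wave_rec j : wave j.+2 + wave j = - 2 * cos (pi / n%:R) * wave j.+1.
Proof.
rewrite /wave; set x := pi / n%:R.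
have -> : j.+2%:R * x = j.+1%:R * x + x by rewrite -[j.+2]addn1 natrD; ring.
have -> : j%:R * x = j.+1%:R * x - x by rewrite -[j.+1]addn1 natrD; ring.
by rewrite cosB cosD !exprS; ring.
Qed.

Lemma eigenvalue_odd_cycle :
  eigenvalue (laplacian R (cycle_graph k.*2.+3)) (2 + 2 * cos (pi / k.*2.+3%:R)).
Proof.
apply/eigenvalue_laplacianP; exists (fun i : 'I_(k.*2.+3) => wave i); split.
  by exists ord0; rewrite /wave mul0r cos0 mulr1 expr0 oner_eq0.
move=> i; rewrite /laplace natr_degree_cycle_graph.
rewrite (sum_adj_cycle_graph i (fun i : 'I_(k.*2.+3) => wave i)) /=.
rewrite -/n !wave_mod.
(* Shifting by one period keeps the predecessor of vertex 0 within the natural numbers. *)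
have := wave_rec (i + n).-1; rewrite -(waveDn i) -(waveDn i.+1) addSn.
have -> : (i + n).-1.+1 = (i + n)%N by rewrite prednK // addn_gt0 orbT.
by move=> ->; ring.
Qed.

End OddCycle.

(** Here 1 - cos x = 2 sin(x/2)^2, and the mean value theorem bounds sin(x/2)^2 by (x/2)^2. *)
Lemma one_minus_cos_le (x : R) : 0 <= x -> 1 - cos x <= x ^+ 2 / 2.
Proof.
move=> x0; set y := x / 2; have y0 : 0 <= y by rewrite divr_ge0.
have -> : x = y *+ 2 by rewrite -mulr_natr divfK.
have [c _] : exists2 c, c \in `[0, y] & sin y - sin 0 = cos c * (y - 0).
  apply: MVT_segment => //.
  by apply: continuous_subspaceT; exact: continuous_sin.
rewrite sin0 !subr0 => sE; have c1 : cos c ^+ 2 <= 1.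
  by rewrite -(cos2Dsin2 c) lerDl sqr_ge0.
have := ler_wpM2r (sqr_ge0 y) c1; rewrite -exprMn -sE sin2cos2 mul1r.
have -> : (y *+ 2) ^+ 2 / 2 = 2 * y ^+ 2 by field.
by rewrite cos_mulr2n; lra.
Qed.

Lemma spec_odd_cycle_le k :
  spec R (cycle_graph k.*2.+3) <= pi ^+ 2 / 4 * (k.*2.+3%:R)^-1.
Proof.
have lam := eigenvalue_le_lambda_max (eigenvalue_odd_cycle k).
rewrite spec_cycle_graph; set n : R := k.*2.+3%:R in lam *.
have n0 : 0 < n by rewrite ltr0n.
have := one_minus_cos_le (divr_ge0 (pi_ge0 R) (ltW n0)).
set c := cos _ in lam *; set L := lambda_max _ _ in lam * => cle.
have : 4 - L <= (pi / n) ^+ 2.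
  by move: cle; move: (_ ^+ 2) => q cle; lra.
have -> : pi ^+ 2 / 4 * n^-1 = n * (pi / n) ^+ 2 / 4.
  by field; rewrite gt_eqF.
by move=> le4; rewrite ler_pM2r ?invr_gt0 // ler_pM2l.
Qed.

Lemma cvg_spec_odd_cycle :
  ((fun k : nat => spec R (cycle_graph k.*2.+1)) @ \oo --> (0 : R))%classic.
Proof.
(* Dropping k = 0 leaves the cycles with at least three vertices. *)
rewrite -cvg_shiftS /=.
apply: (@squeeze_cvgr _ _ _ _ (fun=> 0) (fun k => pi ^+ 2 / 4 * harmonic k)).
- near=> k; rewrite spec_cycle_graph_ge0 /=.
  apply: (le_trans (spec_odd_cycle_le k)); rewrite ler_wpM2l //.
    by rewrite divr_ge0 ?sqr_ge0.
  by rewrite /harmonic lef_pV2 ?posrE ?ltr0n // ler_nat; lia.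
- exact: cvg_cst.
- rewrite -[X in (_ --> X)%classic](mulr0 (pi ^+ 2 / 4)).
  by apply: cvgMl_tmp; exact: cvg_harmonic.
Unshelve. all: by end_near.
Qed.

End CycleGraph.

Local Open Scope classical_set_scope.
Local Open Scope ring_scope.

Theorem proposition9 (R : realType) :
  (* both are lower bounds for the frustration index *)
  (forall (G : sgraph) (o : orientation G),
      (maxcut_defect G <= frustration (antisym_line o))%N /\
      spec R G <= (frustration (antisym_line o))%:R) /\
  (* they are incomparable *)
  ~ (forall G : sgraph, (maxcut_defect G)%:R <= spec R G) /\
  ~ (forall G : sgraph, spec R G <= (maxcut_defect G)%:R) /\
  (* (i) *)
  (forall k : nat, (0 < k)%N ->
     forall o : orientation (cycle_graph k.*2.+1),
       maxcut_defect (cycle_graph k.*2.+1) = frustration (antisym_line o)) /\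
  ((fun k : nat => spec R (cycle_graph k.*2.+1)) @ \oo --> (0 : R)) /\
  (* (ii) *)
  (forall G : sgraph, complete_multipartite G ->
     forall o : orientation G,
       spec R G = 3 / 4 * (frustration (antisym_line o))%:R).
Proof.
split; first by move=> G o; split; [exact: maxcut_defect_le | exact: spec_le].
split.
  (* In K_3 all degrees are 2, so the defect equals the frustration index, while spec is 3/4 > 0 and
     only three quarters of that index. *)
  move=> /(_ (complete_graph 3)) le3.
  case: (orientation_exists (complete_graph 3)) => o.
  have deg_le2 : forall v : complete_graph 3, (degree v <= 2)%N.
    by move=> v; rewrite complete_graph_degree.
  have := spec_complete_graph 3 R.
  have := spec_frustration_multipartite (G := complete_graph 3) (part := id)
    (fun _ _ => erefl) R o.
  rewrite -(maxcut_defect_degree2 o deg_le2) /=; move: le3; lra.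
split.
  (* In K_7 spec is 7 * 6 * 5 / 8 = 26.25, which exceeds even the number 21 of edges. *)
  move=> /(_ (complete_graph 7)) le7.
  have def_le : (maxcut_defect (complete_graph 7))%:R <=
      #|edges (complete_graph 7)|%:R :> R.
    by rewrite ler_nat leq_subr.
  have := complete_graph_edges 7 R; have := spec_complete_graph 7 R.
  by rewrite /=; move: le7 def_le; lra.
split.
  move=> k _ o; apply: maxcut_defect_degree2; exact: cycle_graph_degree_le.
split; first exact: cvg_spec_odd_cycle.
by move=> G [I [part adjE]] o; exact: spec_frustration_multipartite adjE R o.
Qed.
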